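(* Let $M\in[0,\infty]$ and $L\in(0,\infty]$, let $I$ be an index set, and let $x_i\in\mathbb{E}$, $g_i\in\mathbb{E}^*$, $f_i\in\mathbb{R}$ for $i\in I$. The set $\{(x_i,g_i,f_i)\}_{i\in I}$ is $\mathcal{C}_{M,L}$-interpolable (resp. $\mathcal{C}'_{M,L}$-interpolable) if and only if the following conditions hold for every pair of indices $i\in I$ and $j\in I$: $$f_i-f_j-\langle g_j,x_i-x_j\rangle\geq\frac{1}{2L}\|g_i-g_j\|_{\mathbb{E}^*}^2,$$ $$\|g_j\|_{\mathbb{E}^*}\leq M\qquad(\text{resp. }\|g_j-g_i\|_{\mathbb{E}^*}\leq M).$$
   Context: $\mathbb{E}$ is a finite-dimensional real vector space with dual $\mathbb{E}^*$, $\langle\cdot,\cdot\rangle:\mathbb{E}^*\times\mathbb{E}\to\mathbb{R}$ is a dual pairing (nondegenerate bilinear map), $B:\mathbb{E}\to\mathbb{E}^*$ is a self-adjoint positive definite linear operator, $\|x\|_{\mathbb{E}}^2=\langle Bx,x\rangle$ for $x\in\mathbb{E}$ and $\|s\|_{\mathbb{E}^*}^2=\langle s,B^{-1}s\rangle$ for $s\in\mathbb{E}^*$. Convention: $1/\infty=0$. $\mathcal{C}_{M,L}(\mathbb{E})$ ($L$-smooth $M$-Lipschitz convex functions) is the set of proper, closed, convex functions $f:\mathbb{E}\to\mathbb{R}\cup\{\infty\}$ such that (a) $\frac1L\|g_1-g_2\|_{\mathbb{E}^*}\leq\|x_1-x_2\|_{\mathbb{E}}$ for all $x_1,x_2\in\mathbb{E}$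 and all $g_1\in\partial f(x_1)$, $g_2\in\partial f(x_2)$; and (c) $\|g\|_{\mathbb{E}^*}\leq M$ for every subgradient $g$ (i.e. every $g$ with $g\in\partial f(x)$ for some $x$). $\mathcal{C}'_{M,L}(\mathbb{E})$ is defined in the same way, but with (c) replaced by (c$'$): $\|g_1-g_2\|_{\mathbb{E}^*}\leq M$ for all subgradients $g_1\in\partial f(x_1)$, $g_2\in\partial f(x_2)$, $x_1,x_2\in\mathbb{E}$. For a class $\mathcal{F}(\mathbb{E})$ of convex functions, a set $\{(x_i,g_i,f_i)\}_{i\in I}\subset\mathbb{E}\times\mathbb{E}^*\times\mathbb{R}$ is $\mathcal{F}$-interpolable if there exists $F\in\mathcal{F}(\mathbb{E})$ such that $g_i\in\partial F(x_i)$ and $F(x_i)=f_i$ for all $i\in I$, where $\partial F$ is the convex subdifferential (with respect to the pairing $\langle\cdot,\cdot\rangle$). *)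

(* Defs.v *)
From HB Require Import structures.
From mathcomp Require Import all_boot all_order all_algebra.
From mathcomp Require Import all_classical all_reals all_analysis.

Set Implicit Arguments.
Unset Strict Implicit.
Unset Printing Implicit Defensive.

Import Order.TTheory GRing.Theory Num.Theory.
Import numFieldNormedType.Exports.

Local Open Scope classical_set_scope.
Local Open Scope ring_scope.

Definition nondegenerate_pairing (R : realType) (E Es : vectType R)
    (pair : {bilinear Es -> E -> R | *%R & *%R}) : Prop :=
  (forall s : Es, (forall x : E, pair s x = 0) -> s = 0) /\
  (forall x : E, (forall s : Es, pair s x = 0) -> x = 0).

Definition self_adjoint (R : realType) (E Es : vectType R)
    (pair : {bilinear Es -> E -> R | *%R & *%R}) (B : 'Hom(E, Es)) : Prop :=
  forall x y : E, pair (B x) y = pair (B y) x.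

Definition positive_definite (R : realType) (E Es : vectType R)
    (pair : {bilinear Es -> E -> R | *%R & *%R}) (B : 'Hom(E, Es)) : Prop :=
  forall x : E, x != 0 -> 0 < pair (B x) x.

Definition primal_norm (R : realType) (E Es : vectType R)
    (pair : {bilinear Es -> E -> R | *%R & *%R}) (B : 'Hom(E, Es))
    (x : E) : R :=
  Num.sqrt (pair (B x) x).

(* [(B^-1)%VF] is in general only a right inverse on the range of B; it is the
   inverse of B as soon as the pairing is nondegenerate and B is positive
   definite. *)
Definition dual_norm (R : realType) (E Es : vectType R)
    (pair : {bilinear Es -> E -> R | *%R & *%R}) (B : 'Hom(E, Es))
    (s : Es) : R :=
  Num.sqrt (pair s ((B^-1)%VF s)).

(* A function E -> R U {oo} is a [f : E -> \bar R] that never takes the value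
   -oo; this is part of [proper_fun]. *)
Definition proper_fun (R : realType) (E : vectType R) (f : E -> \bar R) : Prop :=
  (forall x, f x != -oo%E) /\ (exists x, f x \is a fin_num).

(* Convexity in R U {oo}; recall that 0 * +oo = 0 in [\bar R]. *)
Definition convex_efun (R : realType) (E : vectType R) (f : E -> \bar R) : Prop :=
  forall (x y : E) (t : R), 0 <= t <= 1 ->
    (f (t *: x + (1 - t) *: y)%R <= t%:E * f x + (1 - t)%:E * f y)%E.

(* The epigraph is closed. A [vectType] carries no topology: the usual topology
   of E (that of any norm on E) is read off in the coordinates of a basis. *)
Definition closed_efun (R : realType) (E : vectType R) (f : E -> \bar R) : Prop :=
  closed [set p : 'rV[R]_(\dim {:E}) * R |
            (f (passmx.vecof (vbasis {:E}) p.1) <= p.2%:E)%E].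

(* For a proper f, this set is empty when f x = +oo. *)
Definition subdifferential (R : realType) (E Es : vectType R)
    (pair : {bilinear Es -> E -> R | *%R & *%R})
    (f : E -> \bar R) (x : E) : set Es :=
  [set g | forall y : E, (f x + (pair g (y - x))%:E <= f y)%E].

(* [L^-1] is the inverse of extended reals, for which +oo^-1 = 0. *)
Definition smooth_cond (R : realType) (E Es : vectType R)
    (pair : {bilinear Es -> E -> R | *%R & *%R}) (B : 'Hom(E, Es))
    (L : \bar R) (f : E -> \bar R) : Prop :=
  forall (x1 x2 : E) (g1 g2 : Es),
    subdifferential pair f x1 g1 -> subdifferential pair f x2 g2 ->
    (L^-1 * (dual_norm pair B (g1 - g2))%:E
       <= (primal_norm pair B (x1 - x2))%:E)%E.

Definition lipschitz_cond (R : realType) (E Es : vectType R)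
    (pair : {bilinear Es -> E -> R | *%R & *%R}) (B : 'Hom(E, Es))
    (M : \bar R) (f : E -> \bar R) : Prop :=
  forall (x : E) (g : Es), subdifferential pair f x g ->
    ((dual_norm pair B g)%:E <= M)%E.

Definition grad_diam_cond (R : realType) (E Es : vectType R)
    (pair : {bilinear Es -> E -> R | *%R & *%R}) (B : 'Hom(E, Es))
    (M : \bar R) (f : E -> \bar R) : Prop :=
  forall (x1 x2 : E) (g1 g2 : Es),
    subdifferential pair f x1 g1 -> subdifferential pair f x2 g2 ->
    ((dual_norm pair B (g1 - g2))%:E <= M)%E.

(* The classes C_{M,L}(E) and C'_{M,L}(E). *)
Definition classC (R : realType) (E Es : vectType R)
    (pair : {bilinear Es -> E -> R | *%R & *%R}) (B : 'Hom(E, Es))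
    (M L : \bar R) : set (E -> \bar R) :=
  [set f | [/\ proper_fun f, closed_efun f, convex_efun f,
               smooth_cond pair B L f & lipschitz_cond pair B M f]].

Definition classC' (R : realType) (E Es : vectType R)
    (pair : {bilinear Es -> E -> R | *%R & *%R}) (B : 'Hom(E, Es))
    (M L : \bar R) : set (E -> \bar R) :=
  [set f | [/\ proper_fun f, closed_efun f, convex_efun f,
               smooth_cond pair B L f & grad_diam_cond pair B M f]].

Definition interpolable (R : realType) (E Es : vectType R)
    (pair : {bilinear Es -> E -> R | *%R & *%R})
    (F : set (E -> \bar R)) (I : Type)
    (x : I -> E) (g : I -> Es) (f : I -> R) : Prop :=
  exists2 h : E -> \bar R, F h &
    forall i : I, subdifferential pair h (x i) (g i) /\ h (x i) = (f i)%:E.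

(* Main.v *)
(* For sufficiency, let k = 1/L and let C be a convex set of slopes containing
   every g_i, which encodes the bound M: a ball, or a set of diameter at most M.
   Let H be the sup over i of <., x_i> - f_i + k/2 |. - g_i|^2, restricted to C.
   It is k-strongly convex, so its conjugate is L-smooth; the inequalities say
   that H(g_i) = <g_i, x_i> - f_i, so the conjugate interpolates, and its
   increments, hence its subgradients, are controlled by C.

   For necessity, the usual proof requires subgradients at every point.  The
   proximal point algorithm only visits points which have one: for the function
   F - <g_j, .>, started at x_i, its total decrease is bounded below by a
   geometric series which tends to |g_i - g_j|^2 / (2L) with the step size. *)

Require Import Defs.
From HB Require Import structures.
From mathcomp Require Import all_boot all_order all_algebra.
From mathcomp Require Import all_classical all_reals all_analysis.
From mathcomp Require Import ring lra.

Set Implicit Arguments.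
Unset Strict Implicit.
Unset Printing Implicit Defensive.

Import Order.TTheory GRing.Theory Num.Theory.
Import numFieldNormedType.Exports.

Local Open Scope classical_set_scope.
Local Open Scope ring_scope.

(** Serves to let [t] tend to 0 in a variational inequality already divided by [t]. *)
Lemma le_affine_lim (R : realFieldType) (a b c : R) :
  (forall t, 0 < t < 1 -> a + t * b <= c) -> a <= c.
Proof.
move=> h; apply/ler_addgt0Pr => e e0.
have n0 : 0 < e + `|b| + 1 by rewrite ltr_wpDl// addr_ge0// ltW.
have b1 : 0 <= `|b| by [].
have {h} : a + e / (e + `|b| + 1) * b <= c.
  by apply: h; rewrite divr_gt0//= ltr_pdivrMr//; lra.
suff : - e <= e / (e + `|b| + 1) * b by lra.
rewrite mulrAC ler_pdivlMr//.
have : - `|b| <= b by rewrite lerNl ler_normr lexx orbT.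
by nra.
Qed.

(** * The inner product induced by [B] *)

Section InnerProduct.
Variables (R : realType) (E Es : vectType R).
Variables (pair : {bilinear Es -> E -> R | *%R & *%R}) (B : 'Hom(E, Es)).
Hypothesis pair_nondeg : nondegenerate_pairing pair.
Hypothesis B_selfadj : self_adjoint pair B.
Hypothesis B_posdef : positive_definite pair B.
Implicit Types (x y z u v : E) (t : R).

(* Slopes are written [B u] with u in E, so that both norms come from [ip]. *)
Definition ip x y : R := pair (B x) y.

Lemma ipC x y : ip x y = ip y x.
Proof. exact: B_selfadj. Qed.

Lemma ipDr x y z : ip x (y + z) = ip x y + ip x z.
Proof. exact: linearDr. Qed.

Lemma ipNr x y : ip x (- y) = - ip x y.
Proof. exact: linearNr. Qed.

Lemma ipZr t x y : ip x (t *: y) = t * ip x y.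
Proof. exact: linearZr_LR. Qed.

Lemma ipDl x y z : ip (y + z) x = ip y x + ip z x.
Proof. by rewrite /ip linearD linearDl. Qed.

Lemma ipNl x y : ip (- y) x = - ip y x.
Proof. by rewrite /ip linearN linearNl. Qed.

Lemma ipZl t x y : ip (t *: y) x = t * ip y x.
Proof. by rewrite /ip linearZ linearZl_LR. Qed.

Lemma ip0r x : ip x 0 = 0.
Proof. exact: linear0r. Qed.

Definition ipE := (ipDr, ipNr, ipZr, ipDl, ipNl, ipZl).

Lemma sqn_ge0 x : 0 <= ip x x.
Proof.
by have [->|/B_posdef/ltW//] := eqVneq x 0; rewrite ip0r.
Qed.

Lemma sqn_eq0 x : ip x x = 0 -> x = 0.
Proof.
by move=> x0; apply/eqP/negP => /negP/B_posdef; rewrite -/(ip x x) x0 ltxx.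
Qed.

Lemma ip_young x y t : 0 < t -> 2 * ip x y <= t * ip x x + t^-1 * ip y y.
Proof.
move=> t0; have := sqn_ge0 (t *: x - y); rewrite !ipE (ipC y x) => h.
rewrite -(ler_pM2l t0) mulrDr mulrA mulVKf ?gt_eqF//.
by lra.
Qed.

(** Cauchy-Schwarz, from the nonnegative square of [ip x x *: y - ip x y *: x]. *)
Lemma ip_sqr_le x y : ip x y ^+ 2 <= ip x x * ip y y.
Proof.
have [->|/B_posdef] := eqVneq x 0; first by rewrite [ip 0 y]ipC !ip0r; lra.
rewrite -/(ip x x) => x0; have := sqn_ge0 (ip x x *: y - ip x y *: x).
rewrite !ipE (ipC y x) => h.
by rewrite -(ler_pM2l x0); nra.
Qed.

(** * Invertibility of [B], coordinates and continuity *)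

Lemma B_inj : lker B == 0%VS.
Proof.
rewrite -subv0; apply/subvP => x; rewrite memv_ker memv0 => /eqP Bx.
by apply/eqP/sqn_eq0; rewrite /ip Bx linear0l.
Qed.

Definition pair_mx : 'M[R]_(\dim {:Es}, \dim {:E}) :=
  \matrix_(i, j) pair ((vbasis {:Es})`_i) ((vbasis {:E})`_j).

Lemma pair_vecof (r : 'rV[R]_(\dim {:Es})) (v : 'rV[R]_(\dim {:E})) :
  pair (passmx.vecof (vbasis {:Es}) r) (passmx.vecof (vbasis {:E}) v) =
  (r *m pair_mx *m v^T) 0 0.
Proof.
rewrite linear_sumr mxE; apply: eq_bigr => j _.
rewrite linearZr_LR mulrC !mxE; congr (_ * _).
rewrite linear_sumlz; apply: eq_bigr => i _.
by rewrite linearZl_LR !mxE.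
Qed.

Lemma row_free_pair_mx : row_free pair_mx.
Proof.
apply: inj_row_free => v v0.
have bEs := vbasisP {:Es}; have bE := vbasisP {:E}.
have [nondegl _] := pair_nondeg.
apply/eqP; rewrite -(passmx.vecof_eq0 bEs); apply/eqP/nondegl => x.
by rewrite -[x](passmx.rVofK bE) pair_vecof v0 mul0mx mxE.
Qed.

Lemma dim_limg_B : \dim (limg B) = \dim {:E}.
Proof. by apply: limg_dim_eq; rewrite (eqP B_inj) capv0. Qed.

(** The range of [B] has the dimension of [E], and row freeness of [pair_mx] bounds the dimension of
    [Es] by it, so [B] is onto. *)
Lemma B_invK : cancel (B^-1)%VF B.
Proof.
move=> s; apply: limg_lfunVK.
suff -> : limg B = fullv by rewrite memvf.
apply/eqP; rewrite eqEdim subvf dim_limg_B.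
by have /eqP <- := row_free_pair_mx; apply: rank_leq_col.
Qed.

Lemma B_K : cancel B (B^-1)%VF.
Proof. exact: lker0_lfunK B_inj. Qed.

(* With Cauchy-Schwarz, this bounds the coordinates by the norm. *)
Lemma coord_ip : exists w : 'I_(\dim {:E}) -> E,
  forall i x, passmx.rVof (vbasis {:E}) x 0 i = ip (w i) x.
Proof.
have /row_fullP[A A1] : row_full pair_mx.
  rewrite /row_full eqn_leq rank_leq_col /= (eqP row_free_pair_mx).
  by rewrite -dim_limg_B; apply: dimvS; apply: subvf.
have bE := vbasisP {:E}.
exists (fun i => (B^-1)%VF (passmx.vecof (vbasis {:Es}) (row i A))) => i x.
rewrite /ip B_invK -[x in RHS](passmx.rVofK bE) pair_vecof -row_mul A1.
by rewrite row1 -rowE !mxE.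
Qed.


Lemma ip_vecof_continuous u :
  continuous
    (fun r : 'rV[R]_(\dim {:E}) => ip u (passmx.vecof (vbasis {:E}) r)).
Proof.
rewrite (_ : (fun r => _) = (fun r : 'rV[R]_(\dim {:E}) =>
    \sum_i r 0 i * ip u ((vbasis {:E})`_i))); last first.
  apply/funext => r; rewrite /ip linear_sumr.
  by apply: eq_bigr => i _; rewrite linearZr_LR.
apply: continuous_big => [|i _ r]; first exact: add_continuous.
exact: (cvgM (@coord_continuous _ _ _ 0 i r) (cvg_cst _)).
Qed.

(** * Subgradients, and suprema of affine functions *)

Lemma subgrad_fin (h : E -> \bar R) x s :
  proper_fun h -> subdifferential pair h x s -> exists a, h x = a%:E.
Proof.
move=> [hNy [y hy]] /(_ y); case E1 : (h x) => [a| |] // hle.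
- by exists a.
- by move: hle hy; rewrite addye// leye_eq => /eqP ->.
- by have := hNy x; rewrite E1 eqxx.
Qed.

Lemma subgrad_le (h : E -> \bar R) x u a y r :
  h x = a%:E -> subdifferential pair h x (B u) -> (h y <= r%:E)%E ->
  a + ip u (y - x) <= r.
Proof.
move=> hx /(_ y) + hy; rewrite hx -EFinD => /le_trans/(_ hy).
by rewrite lee_fin.
Qed.

(* [s] in [S] stands for the affine function of slope [s.1] and value [- s.2]
   at 0. *)
Definition aff_sup (S : set (E * R)) y : \bar R :=
  ereal_sup [set (ip s.1 y - s.2)%:E | s in S].

Lemma aff_sup_ge S s y : S s -> ((ip s.1 y - s.2)%:E <= aff_sup S y)%E.
Proof. by move=> Ss; apply: ereal_sup_ubound; exists s. Qed.

Lemma aff_sup_le S y (r : \bar R) :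
  (forall s, S s -> ((ip s.1 y - s.2)%:E <= r)%E) -> (aff_sup S y <= r)%E.
Proof. by move=> h; apply: ge_ereal_sup => _ [s Ss <-]; exact: h. Qed.

Lemma aff_sup_convex S : convex_efun (aff_sup S).
Proof.
move=> x y t /andP[t0 t1]; apply: aff_sup_le => s Ss.
apply: (@le_trans _ _
  (t%:E * (ip s.1 x - s.2)%:E + (1 - t)%:E * (ip s.1 y - s.2)%:E)%E).
  by rewrite -!EFinM -EFinD lee_fin !ipE; lra.
by apply: leeD; apply: lee_wpmul2l; rewrite ?lee_fin ?subr_ge0//;
  exact: aff_sup_ge.
Qed.

Lemma aff_sup_closed S : closed_efun (aff_sup S).
Proof.
rewrite /closed_efun (_ : [set p | _] = \bigcap_(s in S)
    ((fun p => p.2 - ip s.1 (passmx.vecof (vbasis {:E}) p.1)) @^-1`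
       [set r | - s.2 <= r])); last first.
  apply/seteqP; split=> p /= hp.
    move=> s Ss /=; have := le_trans (aff_sup_ge _ Ss) hp.
    by rewrite lee_fin; lra.
  by apply: aff_sup_le => s /hp /=; rewrite lee_fin; lra.
apply: closed_bigI => s _; apply: preimage_closed; last exact: closed_ge.
move=> p _; apply: cvgB; first exact: cvg_snd.
apply: (@cvg_comp _ _ _ fst
  (fun r => ip s.1 (passmx.vecof (vbasis {:E}) r)) _ (nbhs p.1)).
  exact: cvg_fst.
exact: ip_vecof_continuous.
Qed.

(** A shift by [d] raises every affine piece by at most [n], hence also the supremum. Linear bounds
    on slopes thus pass to subgradients. *)
Lemma aff_sup_grad_le S x u a d n :
  aff_sup S x = a%:E -> subdifferential pair (aff_sup S) x (B u) ->
  (forall s, S s -> ip s.1 d <= n) -> ip u d <= n.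
Proof.
move=> hx hu hS.
have : (aff_sup S (x + d) <= (a + n)%:E)%E.
  apply: aff_sup_le => s Ss; have := aff_sup_ge x Ss; rewrite hx !lee_fin.
  by have := hS _ Ss; rewrite !ipE; lra.
by move/(subgrad_le hx hu); rewrite (addrC x) addrK; lra.
Qed.

(** Here [S] is thought of as the epigraph of a function of the slope, with conjugate
    [aff_sup S]. *)
Definition strongly_convex (k : R) (S : set (E * R)) :=
  forall s s' t, 0 <= t <= 1 -> S s -> S s' ->
    S (t *: s.1 + (1 - t) *: s'.1,
       t * s.2 + (1 - t) * s'.2
         - k / 2 * (t * (1 - t)) * ip (s.1 - s'.1) (s.1 - s'.1)).

(** A piece [s] is mixed with weight [t] into every piece [s']. The mixture is at most [a] at [x],
    and by Young's inequality its strong convexity gain bounds [s'] at [x - t *: d]. The subgradient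
    inequality at that point, divided by [t], gives the claim as [t] tends to 0. *)
Lemma aff_sup_descent k S x u a y :
  0 < k -> strongly_convex k S -> aff_sup S x = a%:E ->
  subdifferential pair (aff_sup S) x (B u) ->
  (aff_sup S y <= (a + ip u (y - x) + k^-1 / 2 * ip (y - x) (y - x))%:E)%E.
Proof.
move=> k0 scS hx hu; apply: aff_sup_le => s Ss; rewrite lee_fin.
rewrite -[in ip s.1 y](subrK x y); set d := y - x; rewrite ipDr.
apply: (@le_affine_lim _ _
  (- ip s.1 d + ip u d + k^-1 / 2 * ip d d)) => t /andP[t0 t1].
have tt : 0 < t * (1 - t) by nra.
set r := a + t * (1 - t) * (k^-1 / 2 * ip d d)
           - t * (ip s.1 (x + (1 - t) *: d) - s.2).
have : (aff_sup S (x - t *: d) <= (r / (1 - t))%:E)%E.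
  apply: aff_sup_le => s' Ss'; rewrite lee_fin ler_pdivlMr ?subr_gt0// /r.
  have t01 : 0 <= t <= 1 by rewrite !ltW.
  have := aff_sup_ge x (scS s s' t t01 Ss Ss'); rewrite hx lee_fin /=.
  have := ip_young (s.1 - s'.1) d k0.
  move: (ip (s.1 - s'.1) (s.1 - s'.1)) (ip d d) => W D.
  rewrite !ipE -(ler_pM2l tt) => yg h.
  by nra.
move/(subgrad_le hx hu); rewrite ler_pdivlMr ?subr_gt0// /r.
rewrite (addrAC x) subrr add0r !ipE => h.
by rewrite -(ler_pM2l t0); nra.
Qed.

(** The point [x + k *: (v - u)] minimizes the quadratic upper bound minus [ip v]; there the bound
    meets the subgradient inequality at [y]. *)
Lemma descent_cocoercive k (h : E -> \bar R) x y u v a b :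
  0 < k -> h x = a%:E -> h y = b%:E -> subdifferential pair h y (B v) ->
  (forall z,
    (h z <= (a + ip u (z - x) + k^-1 / 2 * ip (z - x) (z - x))%:E)%E) ->
  k / 2 * ip (u - v) (u - v) <= a - b - ip v (x - y).
Proof.
move=> k0 hx hy hv /(_ (x + k *: (v - u)))/(subgrad_le hy hv).
rewrite (addrC x) addrK -addrA !ipE (ipC v u).
rewrite (_ : k^-1 / 2 * _ = k / 2 * (ip v v - 2 * ip u v + ip u u)).
  by lra.
by field; rewrite gt_eqF.
Qed.

(** Cocoercivity in both directions sums to [k * ip (u - v) (u - v) <= ip (u - v) (x - y)];
    Cauchy-Schwarz does the rest. *)
Lemma aff_sup_smooth k S x y u v :
  0 < k -> strongly_convex k S -> proper_fun (aff_sup S) ->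
  subdifferential pair (aff_sup S) x (B u) ->
  subdifferential pair (aff_sup S) y (B v) ->
  k ^+ 2 * ip (u - v) (u - v) <= ip (x - y) (x - y).
Proof.
move=> k0 scS pS hu hv.
have [a hx] := subgrad_fin pS hu; have [b hy] := subgrad_fin pS hv.
have h1 := descent_cocoercive k0 hx hy hv
  (fun z => aff_sup_descent z k0 scS hx hu).
have h2 := descent_cocoercive k0 hy hx hu
  (fun z => aff_sup_descent z k0 scS hy hv).
have h3 : k * ip (u - v) (u - v) <= ip (u - v) (x - y).
  by move: h1 h2; rewrite !ipE (ipC v u); lra.
have [->|uv0] := eqVneq (u - v) 0; first by rewrite ip0r mulr0 sqn_ge0.
have := B_posdef uv0; rewrite -/(ip _ _) => w0.
have := ip_sqr_le (u - v) (x - y).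
have kw0 : 0 < k * ip (u - v) (u - v) by rewrite mulr_gt0.
move: h3 w0 kw0; set W := ip (u - v) _; set Q := ip (u - v) _.
set D := ip (x - y) _ => h3 w0 kw0 h.
rewrite -(ler_pM2l w0); apply: le_trans h.
rewrite (_ : W * (k ^+ 2 * W) = (k * W) ^+ 2); last by ring.
by rewrite lerXn2r// nnegrE ltW// (lt_le_trans kw0).
Qed.

(** * The interpolating function *)

Definition convex_pred (C : set E) :=
  forall u v t, 0 <= t <= 1 -> C u -> C v -> C (t *: u + (1 - t) *: v).

Section Interpolant.
Variables (I : Type) (x u : I -> E) (f : I -> R) (k : R) (C : set E).

(* The interpolant is the conjugate of the function with this epigraph. *)
Definition conj_epi : set (E * R) :=
  [set s | C s.1 /\ forall i,
     ip s.1 (x i) - f i + k / 2 * ip (s.1 - u i) (s.1 - u i) <= s.2].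

(** Along a segment, the quadratic in each constraint falls below its chord by exactly the term
    subtracted in [strongly_convex]. *)
Lemma conj_epi_strongly_convex : convex_pred C -> strongly_convex k conj_epi.
Proof.
move=> convC s s' t t01 [Cs hs] [Cs' hs']; split=> [|i]; first exact: convC.
rewrite /= (_ : t *: s.1 + (1 - t) *: s'.1 - u i =
  t *: (s.1 - u i) + (1 - t) *: (s'.1 - u i)); last first.
  by rewrite !scalerBr addrACA -opprD -scalerDl (addrC t) subrK scale1r.
rewrite (_ : s.1 - s'.1 = (s.1 - u i) - (s'.1 - u i)); last first.
  by rewrite opprB addrA subrK.
move: (hs i) (hs' i); case/andP: t01 => t0; rewrite -subr_ge0 => t1.
move: (s.1 - u i) (s'.1 - u i) => p q.
rewrite !ipE (ipC q p) => h h'.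
have := ler_wpM2l t0 h; have := ler_wpM2l t1 h'.
by lra.
Qed.

Hypothesis interp : forall i j,
  k / 2 * ip (u i - u j) (u i - u j) <= f i - f j - ip (u j) (x i - x j).
Hypothesis Cu : forall i, C (u i).

(** The constraint of index [j] at this pair is the interpolation inequality for [j] and [i]. *)
Lemma conj_epi_data (i : I) : conj_epi (u i, ip (u i) (x i) - f i).
Proof.
split=> [|j] /=; first exact: Cu.
have := interp j i; rewrite !ipE (ipC (u j) (u i)); lra.
Qed.

Lemma aff_sup_interp (i : I) : 0 <= k -> aff_sup conj_epi (x i) = (f i)%:E.
Proof.
move=> k0; apply/eqP; rewrite eq_le; apply/andP; split.
  apply: aff_sup_le => s [_ /(_ i)]; rewrite lee_fin.
  have : 0 <= k / 2 * ip (s.1 - u i) (s.1 - u i).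
    by rewrite mulr_ge0 ?sqn_ge0// divr_ge0.
  by lra.
by apply: le_trans (aff_sup_ge _ (conj_epi_data i)); rewrite lee_fin /=; lra.
Qed.

Lemma aff_sup_interp_subgrad (i : I) : 0 <= k ->
  subdifferential pair (aff_sup conj_epi) (x i) (B (u i)).
Proof.
move=> k0 y; rewrite aff_sup_interp// -EFinD.
apply: le_trans (aff_sup_ge _ (conj_epi_data i)).
by rewrite lee_fin /= -/(ip _ _) !ipE; lra.
Qed.

Lemma aff_sup_interp_proper (i : I) : 0 <= k -> proper_fun (aff_sup conj_epi).
Proof.
move=> k0; split=> [y|]; last by exists (x i); rewrite aff_sup_interp.
have := aff_sup_ge y (conj_epi_data i).
by case: (aff_sup _ _).
Qed.

End Interpolant.

(** * Proximal points and the gap inequality for smooth functions *)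

Lemma convex_efun_le (h : E -> \bar R) x y a b t :
  convex_efun h -> 0 <= t <= 1 -> (h x <= a%:E)%E -> (h y <= b%:E)%E ->
  (h (t *: x + (1 - t) *: y)%R <= (t * a + (1 - t) * b)%:E)%E.
Proof.
move=> ch t01 hx hy; apply: le_trans (ch x y t t01) _.
case/andP: t01 => t0 t1; rewrite (EFinD (t * a)) !EFinM.
by apply: leeD; apply: lee_wpmul2l; rewrite ?lee_fin ?subr_ge0.
Qed.

Lemma sqn_vecof_continuous : continuous (fun r : 'rV[R]_(\dim {:E}) =>
  ip (passmx.vecof (vbasis {:E}) r) (passmx.vecof (vbasis {:E}) r)).
Proof.
set V := passmx.vecof _.
rewrite (_ : (fun r => _) = (fun r : 'rV[R]_(\dim {:E}) =>
    \sum_i r 0 i * ip ((vbasis {:E})`_i) (V r))); last first.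
  apply/funext => r; rewrite {2}/V /ip linear_sumr.
  by apply: eq_bigr => i _; rewrite linearZr_LR -/(ip _ _) ipC.
apply: continuous_big => [|i _ r]; first exact: add_continuous.
exact: (cvgM (@coord_continuous _ _ _ 0 i r) (@ip_vecof_continuous _ r)).
Qed.

(** Completeness is borrowed from row vectors: [coord_ip] and Cauchy-Schwarz make the coordinates a
    Cauchy sequence. *)
Lemma cauchy_coord_cvg (y : nat -> E) (K : R) :
  (forall m n, (m <= n)%N -> ip (y m - y n) (y m - y n) <= K * m.+1%:R^-1) ->
  exists r : 'rV[R]_(\dim {:E}),
    passmx.rVof (vbasis {:E}) (y n) @[n --> \oo] --> r.
Proof.
move=> hy; have [w hw] := coord_ip.
apply/cvg_ex/cauchy_cvgP/cauchy_exP => e e0.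
set W := \sum_i ip (w i) (w i).
have Wle i : ip (w i) (w i) <= W.
  rewrite /W (bigD1 i)//= lerDl; apply: sumr_ge0 => j _; exact: sqn_ge0.
have W0 : 0 <= W by apply: sumr_ge0 => j _; exact: sqn_ge0.
have [N hN] : exists N : nat, W * (K * N.+1%:R^-1) < e ^+ 2.
  exists (Num.truncn (W * K / e ^+ 2)).
  rewrite mulrA ltr_pdivrMr ?ltr0n// [ltRHS]mulrC -ltr_pdivrMr ?exprn_gt0//.
  exact: truncnS_gt.
exists (passmx.rVof (vbasis {:E}) (y N)).
exists N => // n /= Nn; split=> // i j.
rewrite (ord1 i) /ball /= !hw -ipNr -ipDr.
rewrite -ltr_sqr ?nnegrE ?(ltW e0)// real_normK ?num_real//.
apply: le_lt_trans (ip_sqr_le _ _) _; apply: le_lt_trans hN.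
by apply: ler_pM; rewrite ?sqn_ge0 ?hy.
Qed.

(* [p] minimizes [h + k |. - z|^2]; by strong convexity the minimizing
   sequences are Cauchy. *)
Lemma prox_exists (h : E -> \bar R) x0 u0 z k :
  proper_fun h -> closed_efun h -> convex_efun h ->
  subdifferential pair h x0 (B u0) -> 0 < k ->
  exists p, subdifferential pair h p (B ((2 * k) *: (z - p))).
Proof.
move=> ph clh ch hu0 k0; have [a ha] := subgrad_fin ph hu0.
have hNy x : h x != -oo%E by case: ph.
(* Points of the epigraph replace values of [h], which may be infinite. *)
pose T := [set r | exists2 yc : E * R, (h yc.1 <= yc.2%:E)%E &
  r = yc.2 + k * ip (yc.1 - z) (yc.1 - z)].
have Tlb : has_lbound T.
  (* The affine minorant at [x0] plus the square is bounded below by Young's inequality with weight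
     [k^-1 / 2]. *)
  exists (a + ip u0 (z - x0) - k^-1 / 4 * ip u0 u0) => _ [[y c] /= hy ->].
  have := subgrad_le ha hu0 hy.
  have kk0 : 0 < k^-1 / 2 by rewrite divr_gt0 ?invr_gt0.
  have := ip_young u0 (z - y) kk0; rewrite invf_div invrK.
  by rewrite !ipE (ipC z y); lra.
have T0 : has_inf T.
  by split=> //; exists (a + k * ip (x0 - z) (x0 - z)), (x0, a); rewrite //= ha.
set m := inf T.
have mle y c : (h y <= c%:E)%E -> m <= c + k * ip (y - z) (y - z).
  by move=> hy; apply: ge_inf => //; exists (y, c).
have /choice[w hw] : forall n : nat, exists yc : E * R,
    (h yc.1 <= yc.2%:E)%E /\
    yc.2 + k * ip (yc.1 - z) (yc.1 - z) < m + n.+1%:R^-1.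
  move=> n; have n0 : 0 < n.+1%:R^-1 :> R by rewrite invr_gt0 ltr0n.
  by have [_ [yc hyc ->] lt] := inf_adherent n0 T0; exists yc.
have wC i j : (i <= j)%N ->
    ip ((w i).1 - (w j).1) ((w i).1 - (w j).1) <= 4 * k^-1 * i.+1%:R^-1.
  move=> ij; have [hi mi] := hw i; have [hj mj] := hw j.
  have half : 0 <= (2^-1 : R) <= 1 by lra.
  (* The midpoint of two near-minimizers cannot go below [m]; the parallelogram law then bounds
     their distance. *)
  have hm := mle _ _ (convex_efun_le ch half hi hj).
  have ji : j.+1%:R^-1 <= i.+1%:R^-1 :> R.
    by rewrite lef_pV2 ?posrE ?ltr0n// ler_nat ltnS.
  rewrite -(ler_pM2l k0) [leRHS]mulrA (mulrCA k) mulfV ?gt_eqF// mulr1.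
  move: hm mi mj ji; move: (i.+1%:R^-1) (j.+1%:R^-1) => ri rj.
  move: (w i) (w j) => [y c] [y' c'] /=.
  rewrite !ipE (ipC y' y) (ipC z y) (ipC z y').
  by lra.
have [r wr] := cauchy_coord_cvg wC.
pose V := passmx.vecof (vbasis {:E}).
pose v n := passmx.rVof (vbasis {:E}) (w n).1.
have VK n : V (v n) = (w n).1.
  by apply: passmx.rVofK; exact: vbasisP.
set p := V r.
have qcvg : ip ((w n).1 - z) ((w n).1 - z) @[n --> \oo] --> ip (p - z) (p - z).
  rewrite (_ : (fun n => _) = (fun n => ip (V (v n)) (V (v n))
    - 2 * ip z (V (v n)) + ip z z)); last first.
    apply/funext => n; rewrite /v VK !ipE (ipC _ z); ring.
  rewrite (_ : ip (p - z) (p - z) = ip p p - 2 * ip z p + ip z z); last first.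
    by rewrite !ipE (ipC p z); ring.
  apply: cvgD; last exact: cvg_cst.
  apply: cvgB; first exact: cvg_comp wr (@sqn_vecof_continuous r).
  apply: cvgM; first exact: cvg_cst.
  exact: cvg_comp wr (@ip_vecof_continuous z r).
(* The heights [(w n).2] are not known to converge; these larger ones do, and the epigraph is
   closed. *)
have ccvg : m + n.+1%:R^-1 - k * ip ((w n).1 - z) ((w n).1 - z) @[n --> \oo]
    --> m - k * ip (p - z) (p - z).
  apply: cvgB; last by apply: cvgM => //; exact: cvg_cst.
  rewrite -[X in _ --> X]addr0; apply: cvgD; first exact: cvg_cst.
  exact: cvg_harmonic.
have hp : (h p <= (m - k * ip (p - z) (p - z))%:E)%E.
  pose u_ n := (v n,
    m + n.+1%:R^-1 - k * ip ((w n).1 - z) ((w n).1 - z)).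
  apply: (@closed_cvg _ _ \oo _ u_ _ clh _ (r, m - k * ip (p - z) (p - z))).
    apply: nearW => n; rewrite /u_ /= -/V VK.
    have [hn mn] := hw n; apply: le_trans hn _.
    by rewrite lee_fin lerBrDr ltW.
  exact: cvg_pair wr ccvg.
exists p => y.
case Ep : (h p) => [b| |];
  [|by move: hp; rewrite Ep|by have := hNy p; rewrite Ep].
case Ey : (h y) => [c| |]; [|by rewrite leey|by have := hNy y; rewrite Ey].
rewrite -EFinD lee_fin -/(ip _ _).
(* First-order optimality: [p] is compared with [p + t *: (y - p)], and the quadratic error vanishes
   after division by [t]. *)
apply: (@le_affine_lim _ _ (- k * ip (y - p) (y - p))) => t /andP[t0 t1].
have t01 : 0 <= t <= 1 by rewrite !ltW.
have hy : (h y <= c%:E)%E by rewrite Ey.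
rewrite Ep lee_fin in hp.
have hp' : (h p <= b%:E)%E by rewrite Ep.
have := mle _ _ (convex_efun_le ch t01 hy hp').
rewrite (_ : t *: y + (1 - t) *: p - z = (p - z) + t *: (y - p)); last first.
  by rewrite scalerBl scale1r scalerBr addrCA addrAC.
rewrite -(opprB p z); move: (y - p) hp => d.
move: (p - z) => e hp.
rewrite !ipE (ipC d e) => h'.
by rewrite -(ler_pM2l t0); lra.
Qed.

(* A proximal step of length m for [h - <v, .>] from x' to p decreases it by
   at least [m |w|^2], where [v + w] is the new subgradient of h, while
   smoothness gives [|w| >= |u' - v| / (1 + m / k)].  So a constant [c]
   admissible in the estimate improves to [(m + c) k^2 / (k + m)^2]; if the
   supremum [c] of these were below [k / 2], then [m = k - 2 c] would exceed
   it. *)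
Lemma smooth_gap (h : E -> \bar R) k x y u v a b :
  proper_fun h -> closed_efun h -> convex_efun h -> 0 < k ->
  (forall x1 x2 u1 u2, subdifferential pair h x1 (B u1) ->
     subdifferential pair h x2 (B u2) ->
     k ^+ 2 * ip (u1 - u2) (u1 - u2) <= ip (x1 - x2) (x1 - x2)) ->
  h x = a%:E -> h y = b%:E ->
  subdifferential pair h x (B u) -> subdifferential pair h y (B v) ->
  k / 2 * ip (u - v) (u - v) <= a - b - ip v (x - y).
Proof.
move=> ph clh ch k0 smh hx hy hu hv.
pose A := [set c : R | 0 <= c /\ forall x' u' a', h x' = a'%:E ->
  subdifferential pair h x' (B u') ->
  c * ip (u' - v) (u' - v) <= a' - b - ip v (x' - y)].
have A0 : A 0.
  split=> // x' u' a' hx' _; rewrite mul0r subr_ge0 lerBrDl.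
  by apply: (subgrad_le hy hv); rewrite hx'.
have step c m : 0 < m -> A c -> A ((m + c) * k ^+ 2 / (k + m) ^+ 2).
  move=> m0 [c0 hc].
  have km0 : 0 < (k + m) ^+ 2 by rewrite exprn_gt0// addr_gt0.
  split=> [|x' u' a' hx' hu'].
    by rewrite divr_ge0 ?mulr_ge0 ?exprn_ge0 ?addr_ge0// ltW.
  have m20 : 0 < m^-1 / 2 by rewrite divr_gt0 ?invr_gt0.
  (* The shift by [m *: v] turns a proximal step for [h] into one for [h - <v, .>] from [x']. *)
  have [p] := prox_exists (x' + m *: v) ph clh ch hv m20.
  rewrite mulrCA mulfV// mulr1 => hp.
  set w := m^-1 *: (x' - p).
  have xpE : x' - p = m *: w by rewrite scalerA mulfV ?gt_eqF// scale1r.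
  have uE : m^-1 *: (x' + m *: v - p) = v + w.
    by rewrite addrAC xpE -scalerDr scalerA mulVf ?gt_eqF// scale1r addrC.
  clearbody w; rewrite uE in hp; have [a'' ha''] := subgrad_fin ph hp.
  have := hc _ _ _ ha'' hp; rewrite (addrC v) addrK => gap.
  have hx'' : (h x' <= a'%:E)%E by rewrite hx'.
  have := subgrad_le ha'' hp hx''; rewrite xpE => desc.
  have := smh _ _ _ _ hu' hp; rewrite xpE => lip.
  have km : 0 < k / m by rewrite divr_gt0.
  (* With weight [k / m], Young's inequality is sharp in the extreme case of [lip], where
     [u' - (v + w)] is [m / k] times as long as [w]. *)
  have := ip_young (u' - (v + w)) w km; rewrite invf_div => yg.
  have uvE : u' - v = (u' - (v + w)) + w by rewrite opprD addrA subrK.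
  have xyE : x' - y = (p - y) + m *: w by rewrite -xpE [RHS]addrC addrA subrK.
  have gap' : (m + c) * ip w w <= a' - b - ip v (x' - y).
    by rewrite xyE; move: gap desc; rewrite !ipE; lra.
  have uv_le : k ^+ 2 * ip (u' - v) (u' - v) <= (k + m) ^+ 2 * ip w w.
    rewrite uvE; move: (u' - (v + w)) lip yg => d lip yg.
    have := ler_wpM2l (exprn_ge0 2 (ltW k0)) yg.
    have -> : k ^+ 2 * (k / m * ip d d + m / k * ip w w) =
        k / m * (k ^+ 2 * ip d d) + k * m * ip w w.
      by field; rewrite !gt_eqF.
    have := ler_wpM2l (ltW km) lip.
    have -> : k / m * ip (m *: w) (m *: w) = k * m * ip w w.
      by rewrite !ipE; field; rewrite gt_eqF.
    by move: lip; rewrite !ipE (ipC w d); lra.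
  rewrite mulrAC ler_pdivrMr// -mulrA.
  have mc0 : 0 <= m + c by rewrite addr_ge0// ltW.
  apply: le_trans (ler_wpM2l mc0 uv_le) _.
  by rewrite mulrCA mulrC ler_pM2r.
have gap0 : 0 <= a - b - ip v (x - y).
  by have := A0.2 _ _ _ hx hu; rewrite mul0r.
have [->|uv0] := eqVneq (u - v) 0; first by rewrite ip0r mulr0.
have := B_posdef uv0; rewrite -/(ip _ _) => q0.
have Aub : has_ubound A.
  exists ((a - b - ip v (x - y)) / ip (u - v) (u - v)) => c [_ hc].
  by rewrite ler_pdivlMr//; exact: hc.
(* Admissibility is a family of upper bounds on [c], so it passes to the supremum. *)
have AsupA : A (sup A).
  split=> [|x' u' a' hx' hu']; first exact: ub_le_sup.
  have [->|uv'0] := eqVneq (u' - v) 0.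
    by have := A0.2 _ _ _ hx' hu'; rewrite mul0r ip0r mulr0.
  have := B_posdef uv'0; rewrite -/(ip _ _) => q'0.
  rewrite -ler_pdivlMr//; apply: ge_sup; first by exists 0.
  by move=> c [_ hc]; rewrite ler_pdivlMr//; exact: hc.
apply: le_trans (AsupA.2 _ _ _ hx hu).
rewrite ler_pM2r// leNgt; apply/negP => ltk.
set c := sup A in AsupA ltk.
have m0 : 0 < k - 2 * c by lra.
have := ub_le_sup Aub (step _ _ m0 AsupA); rewrite -/c leNgt => /negP; apply.
have c0 : 0 <= c := AsupA.1.
have kc0 : 0 < k + (k - 2 * c) by lra.
rewrite ltr_pdivlMr ?exprn_gt0// -subr_gt0.
have -> : (k - 2 * c + c) * k ^+ 2 - c * (k + (k - 2 * c)) ^+ 2 =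
  (k - c) * (k - 2 * c) ^+ 2 by ring.
by rewrite mulr_gt0 ?exprn_gt0// subr_gt0; lra.
Qed.

(** * Norms, and the extended-real bounds [M] and [L] *)

Lemma dual_norm_B u : dual_norm pair B (B u) = Num.sqrt (ip u u).
Proof. by rewrite /dual_norm B_K. Qed.

Lemma ip_le_norm u v : ip u v <= Num.sqrt (ip u u) * Num.sqrt (ip v v).
Proof.
rewrite -sqrtrM ?sqn_ge0//; apply: le_trans (ler_norm _) _.
by rewrite -sqrtr_sqr ler_wsqrtr// ip_sqr_le.
Qed.

(** Turns a linear bound on [u], taken in the direction [u] itself, into a norm bound. *)
Lemma norm_le_of_sqn u (r : R) : 0 <= r ->
  ip u u <= r * Num.sqrt (ip u u) -> Num.sqrt (ip u u) <= r.
Proof.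
move=> r0; rewrite -{1}(sqr_sqrtr (sqn_ge0 u)) expr2.
have [->//|n0] := eqVneq (Num.sqrt (ip u u)) 0.
by rewrite ler_pM2r// lt_def n0 sqrtr_ge0.
Qed.

(** The squared norm of a combination is at most the larger of the two, so one endpoint gives the
    bound, be [M] finite or not. *)
Lemma ball_convex (M : \bar R) p :
  convex_pred [set w | ((Num.sqrt (ip (w - p) (w - p)))%:E <= M)%E].
Proof.
move=> u v t /andP[t0 t1] /= hu hv.
have -> : t *: u + (1 - t) *: v - p = t *: (u - p) + (1 - t) *: (v - p).
  by rewrite !scalerBr addrACA -opprD -scalerDl (addrC t) subrK scale1r.
move: (u - p) (v - p) hu hv => {}u {}v hu hv.
have qE : ip (t *: u + (1 - t) *: v) (t *: u + (1 - t) *: v) =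
    t * ip u u + (1 - t) * ip v v - t * (1 - t) * ip (u - v) (u - v).
  by rewrite !ipE (ipC v u); ring.
have q0 : 0 <= t * (1 - t) * ip (u - v) (u - v).
  by rewrite !mulr_ge0 ?subr_ge0// sqn_ge0.
have [le|/ltW le] := leP (ip u u) (ip v v).
  by apply: le_trans hv; rewrite lee_fin ler_wsqrtr// qE; nra.
by apply: le_trans hu; rewrite lee_fin ler_wsqrtr// qE; nra.
Qed.

Lemma smooth_condP (L : \bar R) k (h : E -> \bar R) :
  (L^-1)%E = k%:E -> 0 <= k ->
  smooth_cond pair B L h <->
  forall x1 x2 u1 u2, subdifferential pair h x1 (B u1) ->
    subdifferential pair h x2 (B u2) ->
    k ^+ 2 * ip (u1 - u2) (u1 - u2) <= ip (x1 - x2) (x1 - x2).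
Proof.
move=> Lk k0.
have eqv x1 x2 u1 u2 :
    (L^-1 * (dual_norm pair B (B u1 - B u2))%:E
       <= (primal_norm pair B (x1 - x2))%:E)%E =
    (k ^+ 2 * ip (u1 - u2) (u1 - u2) <= ip (x1 - x2) (x1 - x2)).
  rewrite Lk -linearB dual_norm_B -EFinM lee_fin -/(ip _ _).
  rewrite -[k in LHS](ger0_norm k0) -sqrtr_sqr -sqrtrM ?sqr_ge0//.
  by rewrite ler_sqrt// sqn_ge0.
split=> [sm x1 x2 u1 u2 h1 h2|sm x1 x2 g1 g2 h1 h2].
  by rewrite -eqv; exact: sm.
by rewrite -(B_invK g1) -(B_invK g2) eqv; apply: sm; rewrite B_invK.
Qed.

(** Treats finite and infinite [L] together: [k] is 0 when [L] is [+oo]. *)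
Lemma invL_fin (L : \bar R) : (0 < L)%E -> exists k, [/\ 0 <= k,
  (L^-1)%E = k%:E & ((2%:E * L)^-1)%E = (k / 2)%:E].
Proof.
case: L => [l| |] // l0.
  rewrite lte_fin in l0; exists l^-1; split.
  - by rewrite invr_ge0 ltW.
  - by rewrite inver gt_eqF.
  - by rewrite -EFinM inver mulf_eq0 gt_eqF//= gt_eqF// invfM mulrC.
by exists 0; split => //; rewrite ?mul0r ?invey// gt0_muley ?invey ?lte_fin.
Qed.

(** * Necessity and sufficiency for slopes [B (u i)] *)

Section Interpolation.
Variables (M L : \bar R) (k : R).
Hypotheses (k_ge0 : 0 <= k) (LV : (L^-1)%E = k%:E).
Variables (I : Type) (x u : I -> E) (f : I -> R).

Lemma interp_necessary (h : E -> \bar R) :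
  proper_fun h -> closed_efun h -> convex_efun h -> smooth_cond pair B L h ->
  (forall i, subdifferential pair h (x i) (B (u i)) /\ h (x i) = (f i)%:E) ->
  forall i j,
  k / 2 * ip (u i - u j) (u i - u j) <= f i - f j - ip (u j) (x i - x j).
Proof.
move=> ph clh ch sm hI i j; have [hi fi] := hI i; have [hj fj] := hI j.
(* For [k = 0] the claim is the subgradient inequality at [x j]. *)
have [k0|k0] := eqVneq k 0.
  rewrite k0 mul0r mul0r subr_ge0 lerBrDl.
  by apply: (subgrad_le fj hj); rewrite fi.
have k_gt0 : 0 < k by rewrite lt_def k0.
exact: (smooth_gap ph clh ch k_gt0 ((smooth_condP _ LV k_ge0).1 sm) fi fj).
Qed.

(** The index [i0] provides a point of finiteness. The last clause hands linear bounds on [C] on to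
    every subgradient; the bounds by [M] are derived from it. *)
Lemma interp_sufficient (C : set E) (i0 : I) :
  convex_pred C -> (forall i, C (u i)) ->
  (forall i j,
    k / 2 * ip (u i - u j) (u i - u j) <= f i - f j - ip (u j) (x i - x j)) ->
  exists h : E -> \bar R,
    [/\ proper_fun h, closed_efun h, convex_efun h & smooth_cond pair B L h] /\
    (forall i, subdifferential pair h (x i) (B (u i)) /\ h (x i) = (f i)%:E) /\
    (forall y v d n, subdifferential pair h y (B v) ->
      (forall c, C c -> ip c d <= n) -> ip v d <= n).
Proof.
move=> convC Cu interp; exists (aff_sup (conj_epi x u f k C)).
have pS := aff_sup_interp_proper interp Cu i0 k_ge0.
split; [split=> //|split].
- exact: aff_sup_closed.
- exact: aff_sup_convex.
- apply/(smooth_condP _ LV k_ge0) => x1 x2 u1 u2 h1 h2.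
  have [->|k0] := eqVneq k 0; first by rewrite expr0n mul0r sqn_ge0.
  have k_gt0 : 0 < k by rewrite lt_def k0.
  apply: (aff_sup_smooth k_gt0 _ pS h1 h2).
  exact: conj_epi_strongly_convex.
- by move=> i; split; [exact: aff_sup_interp_subgrad|exact: aff_sup_interp].
- move=> y v d n hv hC; have [a ha] := subgrad_fin pS hv.
  by apply: (aff_sup_grad_le ha hv) => s [/hC].
Qed.

Lemma classC_interp (i0 : I) : (0 <= M)%E ->
  (forall i j,
    k / 2 * ip (u i - u j) (u i - u j) <= f i - f j - ip (u j) (x i - x j)) ->
  (forall i, ((dual_norm pair B (B (u i)))%:E <= M)%E) ->
  interpolable pair (classC pair B M L) x (B \o u) f.
Proof.
move=> M0 interp uM; pose C := [set w | ((Num.sqrt (ip w w))%:E <= M)%E].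
have convC : convex_pred C.
  by have := ball_convex (M := M) (p := 0); under eq_set do rewrite subr0.
have Cu i : C (u i) by have := uM i; rewrite dual_norm_B.
have [h [[ph clh ch sm] [hI hC]]] := interp_sufficient i0 convC Cu interp.
exists h => //; split=> // y g hg.
rewrite -(B_invK g) dual_norm_B; set v := (B^-1)%VF g.
case: M M0 @C hC {uM convC Cu} => [r| |] // r0 C hC; last by rewrite leey.
rewrite lee_fin; apply: norm_le_of_sqn => //.
apply: (hC y v); first by rewrite B_invK.
move=> c; rewrite /C /= lee_fin => cr; apply: le_trans (ip_le_norm _ _) _.
by rewrite ler_wpM2r ?sqrtr_ge0.
Qed.

Lemma classC'_interp (i0 : I) : (0 <= M)%E ->
  (forall i j,
    k / 2 * ip (u i - u j) (u i - u j) <= f i - f j - ip (u j) (x i - x j)) ->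
  (forall i j, ((dual_norm pair B (B (u i) - B (u j)))%:E <= M)%E) ->
  interpolable pair (classC' pair B M L) x (B \o u) f.
Proof.
move=> M0 interp uM.
pose N p := [set w | ((Num.sqrt (ip (w - p) (w - p)))%:E <= M)%E].
have convN p : convex_pred (N p) by exact: ball_convex.
pose C1 := [set w | forall i, N (u i) w].
(* [C] has diameter at most M: for p, q in [C] the point q is in [C1], so the
   second clause for p applies to it. *)
pose C := [set w | C1 w /\ forall p, C1 p -> N p w].
have convC : convex_pred C.
  move=> v w t t01 [hv hv'] [hw hw'].
  by split=> [i|p Cp]; apply: convN t01 _ _;
    [exact: hv|exact: hw|exact: hv'|exact: hw'].
have Cu i : C (u i).
  split=> [j|p /(_ i)]; rewrite /N /=.
    by rewrite -dual_norm_B linearB; exact: uM.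
  by rewrite -opprB ipNl ipNr opprK.
have [h [[ph clh ch sm] [hI hC]]] := interp_sufficient i0 convC Cu interp.
exists h => //; split=> // y z g g' hg hg'.
rewrite -(B_invK g) -(B_invK g') -linearB dual_norm_B.
rewrite -(B_invK g) in hg; rewrite -(B_invK g') in hg'.
move: ((B^-1)%VF g) ((B^-1)%VF g') hg hg' => v w hv hw.
have diamC p q : C p -> C q -> ((Num.sqrt (ip (p - q) (p - q)))%:E <= M)%E.
  by move=> [_ hp] [hq _]; exact: hp.
case: M M0 diamC => [r| |] // r0 diamC; last by rewrite leey.
rewrite lee_fin; apply: norm_le_of_sqn => //; set d := v - w.
have Cd p q : C p -> C q -> ip p d <= r * Num.sqrt (ip d d) + ip q d.
  move=> Cp Cq; rewrite -lerBlDr -ipNl -ipDl.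
  apply: le_trans (ip_le_norm _ _) _; rewrite ler_wpM2r ?sqrtr_ge0//.
  by rewrite -lee_fin; exact: diamC.
(* The bound through [C] is used at [y] in direction [d], for each [q], and then at [z] in direction
   [- d]; together they bound [ip d d]. *)
have : ip w (- d) <= r * Num.sqrt (ip d d) - ip v d.
  apply: (hC z w) => // q Cq; rewrite ipNr lerBrDl -lerBrDr opprK.
  by apply: (hC y v) => // p Cp; exact: Cd.
by rewrite ipNr {5}/d ipDl ipNl; lra.
Qed.

End Interpolation.

End InnerProduct.

(** * Empty index sets and the two equivalences *)

Lemma interpolable_empty (R : realType) (E Es : vectType R)
    (pair : {bilinear Es -> E -> R | *%R & *%R}) (F : set (E -> \bar R))
    (I : Type) (x : I -> E) (g : I -> Es) (f : I -> R) :
  ~ inhabited I -> F !=set0 -> interpolable pair F x g f.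
Proof. by move=> I0 [h Fh]; exists h => // i; case: I0; exists. Qed.

Theorem theorem3p5 (R : realType) (E Es : vectType R)
    (pair : {bilinear Es -> E -> R | *%R & *%R})
    (pair_nondeg : nondegenerate_pairing pair)
    (B : 'Hom(E, Es))
    (B_selfadj : self_adjoint pair B)
    (B_posdef : positive_definite pair B)
    (M L : \bar R) (M_ge0 : (0 <= M)%E) (L_gt0 : (0 < L)%E)
    (I : Type) (x : I -> E) (g : I -> Es) (f : I -> R) :
  (interpolable pair (classC pair B M L) x g f <->
    forall i j : I,
      ((f i - f j - pair (g j) (x i - x j))%:E
         >= (2%:E * L)^-1 * (dual_norm pair B (g i - g j) ^+ 2)%:E)%E /\
      ((dual_norm pair B (g j))%:E <= M)%E) /\
  (interpolable pair (classC' pair B M L) x g f <->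
    forall i j : I,
      ((f i - f j - pair (g j) (x i - x j))%:E
         >= (2%:E * L)^-1 * (dual_norm pair B (g i - g j) ^+ 2)%:E)%E /\
      ((dual_norm pair B (g j - g i))%:E <= M)%E).
Proof.
have [k [k0 LV L2V]] := invL_fin L_gt0.
have BK := B_invK pair_nondeg B_posdef.
pose u i := (B^-1)%VF (g i).
have gE : g = B \o u by apply/funext => i /=; rewrite BK.
have condE i j : ((2%:E * L)^-1 * (dual_norm pair B (g i - g j) ^+ 2)%:E <=
      (f i - f j - pair (g j) (x i - x j))%:E)%E =
    (k / 2 * ip pair B (u i - u j) (u i - u j) <=
      f i - f j - ip pair B (u j) (x i - x j)).
  rewrite L2V -EFinM lee_fin gE /= -linearB dual_norm_B// sqr_sqrtr//.
  exact: sqn_ge0.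
have dn0 : ((dual_norm pair B (B 0))%:E <= M)%E.
  by rewrite dual_norm_B// ip0r sqrtr0.
(* A single zero datum: its interpolant shows that each class is nonempty, which settles the case of
   an empty [I]. *)
pose z (_ : unit) : E := 0; pose o (_ : unit) : R := 0.
have interp0 i j : k / 2 * ip pair B (z i - z j) (z i - z j) <=
    o i - o j - ip pair B (z j) (z i - z j).
  by rewrite /z /o !subr0 ip0r mulr0 subr0.
split; split.
- move=> [h [ph clh ch sm lip] hI] i j; rewrite condE; split.
    apply: (interp_necessary pair_nondeg B_selfadj B_posdef k0 LV ph clh ch sm).
    by move=> l; rewrite /u BK.
  by have [hj _] := hI j; exact: lip hj.
- move=> cond; have [[i0]|I0] := pselect (inhabited I); last first.
    apply: interpolable_empty => //.
    have [] := classC_interp pair_nondeg B_selfadj B_posdef k0 LV tt M_ge0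
      interp0 (fun=> dn0).
    by move=> h hC _; exists h.
  rewrite gE.
  apply: (classC_interp pair_nondeg B_selfadj B_posdef k0 LV i0) => //.
    by move=> i j; rewrite -condE; have [] := cond i j.
  by move=> i; have [_] := cond i i; rewrite gE.
- move=> [h [ph clh ch sm diam] hI] i j; rewrite condE; split.
    apply: (interp_necessary pair_nondeg B_selfadj B_posdef k0 LV ph clh ch sm).
    by move=> l; rewrite /u BK.
  by have [hi _] := hI i; have [hj _] := hI j; exact: diam hj hi.
- move=> cond; have [[i0]|I0] := pselect (inhabited I); last first.
    apply: interpolable_empty => //.
    have diam0 i j : ((dual_norm pair B (B (z i) - B (z j)))%:E <= M)%E.
      by rewrite -linearB subr0.
    have [] := classC'_interp pair_nondeg B_selfadj B_posdef k0 LV tt M_ge0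
      interp0 diam0.
    by move=> h hC _; exists h.
  rewrite gE.
  apply: (classC'_interp pair_nondeg B_selfadj B_posdef k0 LV i0) => //.
    by move=> i j; rewrite -condE; have [] := cond i j.
  by move=> i j; have [_] := cond j i; rewrite gE.
Qed.
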